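(* Let $X=[x_1,\dots,x_n]=[X_1,\dots,X_c]\in\mathbb{R}^{d\times n}$ be a centered data matrix ($\sum_{i=1}^n x_i=0$), partitioned into classes $X_i=[x_1^i,\dots,x_{n_i}^i]\in\mathbb{R}^{d\times n_i}$ ($1\le i\le c$, $n_i\ge 1$, $\sum_i n_i=n$), and let $1\le m\le d$. Consider the robust LDA problem of minimizing $$J(W,\mu_1,\dots,\mu_c)=\frac{\sum_{i=1}^c\|W^T(X_i-\mu_i\mathbf{1}_i^T)\|_{1,2}}{\|X\|_{1,2}-\|X-WW^TX\|_{1,2}}$$ over $W\in\mathbb{R}^{d\times m}$ with $W^TW=I$ and $\mu_1,\dots,\mu_c\in\mathbb{R}^d$. Then the robust LDA algorithm described in the context decreases the objective value $J$ in each iteration until it converges: if $(W,\mu_1,\dots,\mu_c)$ is the current iterate and $(\tilde W,\tilde\mu_1,\dots,\tilde\mu_c)$ is the iterate produced from it by one iteration, then $$J(\tilde W,\tilde\mu_1,\dots,\tilde\mu_c)\le J(W,\mu_1,\dots,\mu_c).$$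
   Context: For a matrix $M$ with columns $m_j$, $\|M\|_{1,2}=\sum_j\|m_j\|_2$. $\mathbf{1}_i\in\mathbb{R}^{n_i}$ is the all-ones vector; $I$ is the identity matrix; $Tr$ is the trace. The robust LDA algorithm: initialize any $W\in\mathbb{R}^{d\times m}$ with $W^TW=I$, and $\mu_i=\frac{1}{n_i}\sum_{j=1}^{n_i}x_j^i$. One iteration maps $(W,\mu_1,\dots,\mu_c)$ to $(\tilde W,\tilde\mu_1,\dots,\tilde\mu_c)$ as follows. 1. $\lambda=J(W,\mu_1,\dots,\mu_c)$. 2. For $1\le i\le c$, $D_i\in\mathbb{R}^{n_i\times n_i}$ is the diagonal matrix with $j$-th diagonal entry $\frac{1}{2\|W^T(x_j^i-\mu_i)\|_2}$. 3. $D\in\mathbb{R}^{n\times n}$ is the diagonal matrix with $i$-th diagonal entry $\frac{1}{2\|x_i-WW^Tx_i\|_2}$. 4. $A=\sum_{i=1}^c X_i\Big(D_i-\frac{1}{\mathbf{1}_i^TD_i\mathbf{1}_i}D_i\mathbf{1}_i\mathbf{1}_i^TD_i\Big)X_i^T-\lambda XDX^T$. 5. $\tilde\mu_i=\frac{1}{\mathbf{1}_i^TD_i\mathbf{1}_i}X_iD_i\mathbf{1}_i$ for $1\le i\le c$, and $\tilde W\in\arg\min_{V\in\mathbb{R}^{d\times m},\,V^TV=I}Tr(V^TAV)$, i.e. the columns of $\tilde W$ are $m$ orthonormal eigenvectors of $A$ corresponding to its $m$ smallest eigenvalues. The quantities in an iteration are assumed well defined: $\|W^T(x_j^i-\mu_i)\|_2\ne0$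 for all $i,j$, $\|x_i-WW^Tx_i\|_2\neq0$ for all $i$, and the denominator of $J$ is nonzero at both $W$ and $\tilde W$. ''Decreases'' means does not increase; the algorithm has converged when the objective value no longer changes. *)

(* Defs.v *)
From HB Require Import structures.
From mathcomp Require Import all_boot all_order all_algebra.
From mathcomp Require Import reals.

Set Implicit Arguments.
Unset Strict Implicit.
Unset Printing Implicit Defensive.

Import Order.TTheory GRing.Theory Num.Theory.

Local Open Scope ring_scope.

(* The norm that MathComp-Analysis puts on matrices is the sup norm, hence this
   explicit Euclidean norm. *)
Definition norm2 (R : realType) (d : nat) (v : 'cV[R]_d) : R :=
  Num.sqrt (\sum_(k < d) v k ord0 ^+ 2).

Definition norm12 (R : realType) (d n : nat) (M : 'M[R]_(d, n)) : R :=
  \sum_(j < n) norm2 (col j M).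

Definition ones (R : realType) (n : nat) : 'cV[R]_n := const_mx 1.

Definition orthonormal_cols (R : realType) (d m : nat) (W : 'M[R]_(d, m)) :
  Prop := W^T *m W = 1%:M.

Section RobustLDA.

Variables (R : realType) (d m c : nat) (n_ : 'I_c -> nat).

(* The data are given by their classes X_1, ..., X_c; the full data matrix is
   X = [X_1, ..., X_c], with n = \sum_i n_i columns. *)
Variable Xs : forall i : 'I_c, 'M[R]_(d, n_ i).

Definition data_mx : 'M[R]_(d, \sum_(i < c) n_ i) := \mxrow_(i < c) Xs i.

Definition centered : Prop :=
  \sum_(j < \sum_(i < c) n_ i) col j data_mx = 0.

Definition class_mean (i : 'I_c) : 'cV[R]_d :=
  (n_ i)%:R^-1 *: \sum_(j < n_ i) col j (Xs i).

Definition lda_num (W : 'M[R]_(d, m)) (mu : 'I_c -> 'cV[R]_d) : R :=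
  \sum_(i < c) norm12 (W^T *m (Xs i - mu i *m (ones R (n_ i))^T)).

Definition lda_den (W : 'M[R]_(d, m)) : R :=
  norm12 data_mx - norm12 (data_mx - W *m W^T *m data_mx).

Definition lda_obj (W : 'M[R]_(d, m)) (mu : 'I_c -> 'cV[R]_d) : R :=
  lda_num W mu / lda_den W.

Definition class_weight (W : 'M[R]_(d, m)) (mu : 'I_c -> 'cV[R]_d)
    (i : 'I_c) : 'M[R]_(n_ i) :=
  diag_mx (\row_(j < n_ i) (2 * norm2 (W^T *m (col j (Xs i) - mu i)))^-1).

Definition data_weight (W : 'M[R]_(d, m)) : 'M[R]_(\sum_(i < c) n_ i) :=
  diag_mx (\row_(j < \sum_(i < c) n_ i)
    (2 * norm2 (col j data_mx - W *m W^T *m col j data_mx))^-1).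

(* 1_i^T D_i 1_i, the only entry of a 1 x 1 matrix. *)
Definition class_mass (W : 'M[R]_(d, m)) (mu : 'I_c -> 'cV[R]_d)
    (i : 'I_c) : R :=
  ((ones R (n_ i))^T *m class_weight W mu i *m ones R (n_ i)) ord0 ord0.

Definition rlda_mx (W : 'M[R]_(d, m)) (mu : 'I_c -> 'cV[R]_d) : 'M[R]_d :=
  \sum_(i < c)
     (Xs i *m (class_weight W mu i
               - (class_mass W mu i)^-1 *:
                 (class_weight W mu i *m ones R (n_ i)
                  *m (ones R (n_ i))^T *m class_weight W mu i))
           *m (Xs i)^T)
  - lda_obj W mu *: (data_mx *m data_weight W *m data_mx^T).

Definition rlda_mean (W : 'M[R]_(d, m)) (mu : 'I_c -> 'cV[R]_d)
    (i : 'I_c) : 'cV[R]_d :=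
  (class_mass W mu i)^-1 *: (Xs i *m class_weight W mu i *m ones R (n_ i)).

Definition is_argmin_trace (A : 'M[R]_d) (W : 'M[R]_(d, m)) : Prop :=
  orthonormal_cols W /\
  forall V : 'M[R]_(d, m), orthonormal_cols V ->
    \tr (W^T *m A *m W) <= \tr (V^T *m A *m V).

(* Inversion is total (0^-1 = 0), so the nonvanishing of the denominators in an
   iteration from (W, mu) to a next matrix W' is required explicitly. *)
Definition rlda_well_defined (W : 'M[R]_(d, m)) (mu : 'I_c -> 'cV[R]_d)
    (W' : 'M[R]_(d, m)) : Prop :=
  [/\ forall (i : 'I_c) (j : 'I_(n_ i)),
        norm2 (W^T *m (col j (Xs i) - mu i)) != 0,
      forall j : 'I_(\sum_(i < c) n_ i),
        norm2 (col j data_mx - W *m W^T *m col j data_mx) != 0,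
      lda_den W != 0 &
      lda_den W' != 0].

(* A relation rather than a function: the minimizer W' need not be unique. *)
Definition rlda_step (W : 'M[R]_(d, m)) (mu : 'I_c -> 'cV[R]_d)
    (W' : 'M[R]_(d, m)) (mu' : 'I_c -> 'cV[R]_d) : Prop :=
  [/\ rlda_well_defined W mu W',
      forall i : 'I_c, mu' i = rlda_mean W mu i &
      is_argmin_trace (rlda_mx W mu) W'].

(* The first T iterations of the algorithm, all of them well defined; the values
   of the sequences beyond index T are irrelevant. *)
Definition rlda_run (T : nat) (W : nat -> 'M[R]_(d, m))
    (mu : nat -> 'I_c -> 'cV[R]_d) : Prop :=
  [/\ orthonormal_cols (W 0%N),
      forall i : 'I_c, mu 0%N i = class_mean i &
      forall t : nat, (t < T)%N ->
        rlda_step (W t) (mu t) (W t.+1) (mu t.+1)].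

End RobustLDA.

(* Main.v *)
(** The iteration is a majorize-minimize step. For [a > 0] and any [b],
    [b - a <= b^2 / (2a) - a^2 / (2a)], so replacing every norm in
    [num + lambda * \|X - V V^T X\|] by its square, weighted by the current
    residuals, gives a majorizer touching at the current iterate; here
    [lambda = J(W, mu) >= 0] because projections shrink norms. For fixed [V] the
    majorizer is minimized over the centers by the weighted means, and by
    Pythagoras the value at these means is [Tr (V^T A V)] up to a constant. Hence
    [num' <= lambda * den'], and [den' > 0]. *)
Require Import Defs.
From mathcomp Require Import all_boot all_order all_algebra.
From mathcomp Require Import reals ring lra.

Set Implicit Arguments.
Unset Strict Implicit.

Import Order.TTheory GRing.Theory Num.Theory.
Local Open Scope ring_scope.

(** * Norms, projections and weighted scatter matrices *)

Lemma norm2_ge0 (R : realType) (d : nat) (v : 'cV[R]_d) : 0 <= norm2 v.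
Proof. exact: sqrtr_ge0. Qed.

Lemma norm2_sqr (R : realType) (d : nat) (v : 'cV[R]_d) :
  norm2 v ^+ 2 = \tr (v^T *m v).
Proof.
rewrite sqr_sqrtr; last by apply: sumr_ge0 => k _; exact: sqr_ge0.
by rewrite /mxtrace big_ord1 mxE; apply: eq_bigr => k _; rewrite mxE expr2.
Qed.

Lemma trace_weighted_gram (R : realType) (p n : nat) (M : 'M[R]_(p, n))
    (w : 'rV[R]_n) :
  \tr (M *m diag_mx w *m M^T) = \sum_(j < n) w 0 j * norm2 (col j M) ^+ 2.
Proof.
rewrite mul_mx_diag /mxtrace.
under eq_bigr do rewrite mxE.
rewrite exchange_big /=; apply: eq_bigr => j _.
rewrite norm2_sqr /mxtrace big_ord1 mxE mulr_sumr.
by apply: eq_bigr => k _; rewrite !mxE; ring.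
Qed.

(** Pythagoras: [V *m V^T] is the orthogonal projection onto the span of the columns of [V]. *)
Lemma norm2_residual (R : realType) (d m : nat) (V : 'M[R]_(d, m))
    (x : 'cV[R]_d) : orthonormal_cols V ->
  norm2 (x - V *m V^T *m x) ^+ 2 = norm2 x ^+ 2 - norm2 (V^T *m x) ^+ 2.
Proof.
move=> hV; rewrite !norm2_sqr -raddfB /=; congr (\tr _).
rewrite (raddfB trmx) /= !trmx_mul !trmxK mulmxBl !mulmxBr.
by rewrite !mulmxA -(mulmxA _ V^T V) hV mulmx1 subrr subr0.
Qed.

Lemma norm2_residual_le (R : realType) (d m : nat) (V : 'M[R]_(d, m))
    (x : 'cV[R]_d) : orthonormal_cols V ->
  norm2 (x - V *m V^T *m x) <= norm2 x.
Proof.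
move=> hV; rewrite -(@ler_pXn2r _ 2) ?nnegrE ?norm2_ge0 //.
by rewrite norm2_residual // lerBlDr lerDl sqr_ge0.
Qed.

(** Parallel axis theorem in matrix form: [s] is the total weight and [e] the offset of the center
    [nu] from the weighted mean, so moving the center away from that mean costs the rank-one
    term. *)
Lemma weighted_scatter (R : realType) (d n : nat) (X : 'M[R]_(d, n))
    (w : 'rV[R]_n) (nu : 'cV[R]_d) :
  let D := diag_mx w in
  let s := ((ones R n)^T *m D *m ones R n) ord0 ord0 in
  let e := nu - s^-1 *: (X *m D *m ones R n) in
  s != 0 ->
  (X - nu *m (ones R n)^T) *m D *m (X - nu *m (ones R n)^T)^T
  = X *m (D - s^-1 *: (D *m ones R n *m (ones R n)^T *m D)) *m X^T
    + s *: (e *m e^T).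
Proof.
move=> D s e s0; rewrite /e; set u := X *m D *m ones R n.
have hs : (ones R n)^T *m D *m ones R n = s%:M by rewrite [LHS]mx11_scalar.
have hu : (ones R n)^T *m D *m X^T = u^T.
  by rewrite /u !trmx_mul tr_diag_mx mulmxA.
rewrite !(raddfB trmx) /= !trmx_mul trmxK.
rewrite !mulmxBl !mulmxBr !mulmxBl -!scalemxAr -!scalemxAl !mulmxA -/u.
have -> : (s^-1 *: u)^T = s^-1 *: u^T by rewrite linearZ.
rewrite -!scalemxAr.
have -> : nu *m (ones R n)^T *m D *m X^T = nu *m u^T by rewrite -hu !mulmxA.
have -> : u *m (ones R n)^T *m D *m X^T = u *m u^T by rewrite -hu !mulmxA.
have -> : nu *m (ones R n)^T *m D *m ones R n *m nu^T = s *: (nu *m nu^T).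
  by rewrite scalemxAl -mul_mx_scalar -hs !mulmxA.
(* With [u = s] times the weighted mean, both sides are now combinations of [X *m D *m X^T] and the
   outer products of [u] and [nu]. *)
by apply/matrixP => i j; rewrite !mxE; field.
Qed.

(** Termwise, the right side exceeds the left by [(b - a)^2 / (2a)]. *)
Lemma sum_majorize (R : realType) (I : finType) (a b : I -> R) :
  (forall i, 0 < a i) ->
  \sum_i b i - \sum_i a i
  <= \sum_i (2 * a i)^-1 * b i ^+ 2 - \sum_i (2 * a i)^-1 * a i ^+ 2.
Proof.
move=> a0; rewrite -!sumrB; apply: ler_sum => i _.
have ai := a0 i; rewrite -subr_ge0.
have -> : (2 * a i)^-1 * b i ^+ 2 - (2 * a i)^-1 * a i ^+ 2 - (b i - a i)
          = (2 * a i)^-1 * (b i - a i) ^+ 2.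
  by field; rewrite gt_eqF.
by rewrite mulr_ge0 ?sqr_ge0 // invr_ge0 mulr_ge0 // ltW.
Qed.

Lemma col_centered (R : realType) (d m n : nat) (V : 'M[R]_(d, m))
    (X : 'M[R]_(d, n)) (nu : 'cV[R]_d) (j : 'I_n) :
  col j (V^T *m (X - nu *m (ones R n)^T)) = V^T *m (col j X - nu).
Proof.
rewrite !colE -mulmxA mulmxBl; congr (_ *m (_ - _)).
rewrite -mulmxA -colE; apply/matrixP => i k.
by rewrite !mxE big_ord1 !mxE mulr1 (ord1 k).
Qed.

(** * The quadratic majorizer of one iteration *)

Section Step.

Context {R : realType} {d m c : nat} {n_ : 'I_c -> nat}.
Variable Xs : forall i : 'I_c, 'M[R]_(d, n_ i).

Local Notation X := (data_mx Xs).

Lemma lda_numE (V : 'M[R]_(d, m)) (nu : 'I_c -> 'cV[R]_d) :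
  lda_num Xs V nu
  = \sum_(i < c) \sum_(j < n_ i) norm2 (V^T *m (col j (Xs i) - nu i)).
Proof.
by apply: eq_bigr => i _; apply: eq_bigr => j _; rewrite col_centered.
Qed.

Lemma lda_denE (V : 'M[R]_(d, m)) :
  lda_den Xs V = \sum_j norm2 (col j X)
                 - \sum_j norm2 (col j X - V *m V^T *m col j X).
Proof.
congr (_ - _); apply: eq_bigr => j _.
by rewrite linearB /= !colE !mulmxA.
Qed.

Lemma lda_den_ge0 (V : 'M[R]_(d, m)) : orthonormal_cols V -> 0 <= lda_den Xs V.
Proof.
by move=> hV; rewrite lda_denE subr_ge0 ler_sum // => j _; exact: norm2_residual_le.
Qed.

Lemma lda_num_ge0 (V : 'M[R]_(d, m)) (nu : 'I_c -> 'cV[R]_d) :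
  0 <= lda_num Xs V nu.
Proof. by rewrite lda_numE; do 2!apply: sumr_ge0 => ? _; exact: norm2_ge0. Qed.

Variables (W : 'M[R]_(d, m)) (mu : 'I_c -> 'cV[R]_d).

Let a i (j : 'I_(n_ i)) := norm2 (W^T *m (col j (Xs i) - mu i)).
Let b j := norm2 (col j X - W *m W^T *m col j X).

(** The weights are frozen at [(W, mu)], where the value is half of [lda_num]; hence increments, not
    values, are compared below. *)
Definition weighted_num (V : 'M[R]_(d, m)) (nu : 'I_c -> 'cV[R]_d) : R :=
  \sum_(i < c) \sum_(j < n_ i)
    (2 * a j)^-1 * norm2 (V^T *m (col j (Xs i) - nu i)) ^+ 2.

Definition weighted_residual (V : 'M[R]_(d, m)) : R :=
  \sum_j (2 * b j)^-1 * norm2 (col j X - V *m V^T *m col j X) ^+ 2.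

Hypothesis n_gt0 : forall i, (0 < n_ i)%N.
Hypothesis a_neq0 : forall i (j : 'I_(n_ i)), a j != 0.
Hypothesis b_neq0 : forall j, b j != 0.

Let a_gt0 i (j : 'I_(n_ i)) : 0 < a j.
Proof. by rewrite lt_neqAle eq_sym a_neq0 norm2_ge0. Qed.

Let b_gt0 j : 0 < b j.
Proof. by rewrite lt_neqAle eq_sym b_neq0 norm2_ge0. Qed.

Lemma class_mass_gt0 i : 0 < class_mass Xs W mu i.
Proof.
rewrite /class_mass /class_weight mul_mx_diag mxE.
have t0 (j : 'I_(n_ i)) : 0 < (2 * a j)^-1 by rewrite invr_gt0 mulr_gt0.
rewrite (eq_bigr (fun j => (2 * a j)^-1)); last first.
  by move=> j _; rewrite !mxE mul1r mulr1.
rewrite (bigD1 (Ordinal (n_gt0 i))) //= ltr_pwDl // sumr_ge0 // => j _.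
exact: ltW.
Qed.

Lemma weighted_numE (V : 'M[R]_(d, m)) (nu : 'I_c -> 'cV[R]_d) :
  weighted_num V nu
  = \tr (V^T *m (\sum_(i < c)
       (Xs i *m (class_weight Xs W mu i
               - (class_mass Xs W mu i)^-1 *:
                 (class_weight Xs W mu i *m ones R (n_ i)
                  *m (ones R (n_ i))^T *m class_weight Xs W mu i))
           *m (Xs i)^T)) *m V)
    + \sum_(i < c) class_mass Xs W mu i
        * norm2 (V^T *m (nu i - rlda_mean Xs W mu i)) ^+ 2.
Proof.
rewrite mulmx_sumr mulmx_suml raddf_sum -big_split /=.
apply: eq_bigr => i _.
pose M := V^T *m (Xs i - nu i *m (ones R (n_ i))^T).
transitivity (\tr (M *m class_weight Xs W mu i *m M^T)).
  rewrite trace_weighted_gram; apply: eq_bigr => j _.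
  by rewrite mxE col_centered.
rewrite /M trmx_mul trmxK -!(mulmxA V^T) !(mulmxA _ _ V) weighted_scatter; last first.
  by have /gt_eqF/negbT := class_mass_gt0 i.
rewrite -/(class_mass Xs W mu i) -/(rlda_mean Xs W mu i).
set Q := Xs i *m (_ - _) *m _.
rewrite norm2_sqr (mulmxDr _ Q) mulmxDl raddfD /=; congr (_ + _).
rewrite -scalemxAr -scalemxAl mxtraceZ; congr (_ * _).
(* Cyclicity of the trace turns the outer product of the offset into a squared norm. *)
by rewrite [RHS]mxtrace_mulC trmx_mul trmxK !mulmxA.
Qed.

Lemma weighted_residualE (V : 'M[R]_(d, m)) : orthonormal_cols V ->
  weighted_residual V
  = \sum_j (2 * b j)^-1 * norm2 (col j X) ^+ 2
    - \tr (V^T *m (X *m data_weight Xs W *m X^T) *m V).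
Proof.
move=> hV.
have -> : V^T *m (X *m data_weight Xs W *m X^T) *m V
          = (V^T *m X) *m data_weight Xs W *m (V^T *m X)^T.
  by rewrite trmx_mul trmxK !mulmxA.
rewrite trace_weighted_gram -sumrB; apply: eq_bigr => j _.
have -> : col j (V^T *m X) = V^T *m col j X by rewrite !colE mulmxA.
by rewrite norm2_residual // mulrBr mxE.
Qed.

(** At the weighted means the offset terms vanish. The subtracted sum does not depend on [V], so
    minimizing the trace minimizes the majorizer. *)
Lemma rlda_mx_trace (V : 'M[R]_(d, m)) : orthonormal_cols V ->
  \tr (V^T *m rlda_mx Xs W mu *m V)
  = weighted_num V (rlda_mean Xs W mu)
    + lda_obj Xs W mu * (weighted_residual V
        - \sum_j (2 * b j)^-1 * norm2 (col j X) ^+ 2).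
Proof.
move=> hV; rewrite weighted_numE weighted_residualE // [S in _ + S + _]big1.
  rewrite /rlda_mx mulmxBr mulmxBl raddfB /= -scalemxAr -scalemxAl mxtraceZ.
  ring.
move=> i _; rewrite subrr mulmx0 norm2_sqr mulmx0 mxtrace0.
by rewrite mulr0.
Qed.

Lemma weighted_num_mean_le (V : 'M[R]_(d, m)) (nu : 'I_c -> 'cV[R]_d) :
  weighted_num V (rlda_mean Xs W mu) <= weighted_num V nu.
Proof.
rewrite !weighted_numE lerD2l; apply: ler_sum => i _.
rewrite subrr mulmx0 norm2_sqr mulmx0 mxtrace0 mulr0.
by rewrite mulr_ge0 ?sqr_ge0 // ltW // class_mass_gt0.
Qed.

Lemma lda_num_majorize (V : 'M[R]_(d, m)) (nu : 'I_c -> 'cV[R]_d) :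
  lda_num Xs V nu - lda_num Xs W mu <= weighted_num V nu - weighted_num W mu.
Proof.
rewrite !lda_numE /weighted_num -!sumrB; apply: ler_sum => i _.
by apply: (sum_majorize (a := @a i)) => j; exact: a_gt0.
Qed.

Lemma lda_den_majorize (V : 'M[R]_(d, m)) :
  lda_den Xs W - lda_den Xs V <= weighted_residual V - weighted_residual W.
Proof.
(* The norm of the data cancels, leaving only the residual sums. *)
rewrite !lda_denE opprB addrC addrA subrK.
exact: (sum_majorize (a := b)).
Qed.

End Step.

(** * Descent of the objective *)

Lemma lda_obj_step (R : realType) (d m c : nat) (n_ : 'I_c -> nat)
    (Xs : forall i : 'I_c, 'M[R]_(d, n_ i)) (W W' : 'M[R]_(d, m))
    (mu mu' : 'I_c -> 'cV[R]_d) :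
  (forall i, 0 < n_ i)%N -> orthonormal_cols W -> rlda_step Xs W mu W' mu' ->
  lda_obj Xs W' mu' <= lda_obj Xs W mu.
Proof.
move=> hn hW [[a0 b0 den0 den0'] hmu [hW' /(_ W hW) htr]].
(* The new centers are known to be the weighted means only pointwise, so the equality is transferred
   inside the sum. *)
have mu'E : weighted_num Xs W mu W' mu'
            = weighted_num Xs W mu W' (rlda_mean Xs W mu).
  by apply: eq_bigr => i _; rewrite hmu.
rewrite !rlda_mx_trace // in htr.
have hmean := weighted_num_mean_le hn a0 W mu.
have hnum := lda_num_majorize a0 W' mu'.
have l0 : 0 <= lda_obj Xs W mu.
  by rewrite divr_ge0 ?lda_num_ge0 ?lda_den_ge0.
have hden := ler_wpM2l l0 (lda_den_majorize b0 W').
have numE : lda_num Xs W mu = lda_obj Xs W mu * lda_den Xs W by rewrite divfK.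
have d0 : 0 < lda_den Xs W' by rewrite lt_neqAle eq_sym den0' lda_den_ge0.
rewrite [leLHS]/lda_obj ler_pdivrMr //.
(* With [l] the current objective, the hypotheses chain to [num' - num <= l * (den' - den)], and
   [num = l * den]. *)
move: htr hden hmean hnum; rewrite mu'E numE; lra.
Qed.

Unset Implicit Arguments.
Set Strict Implicit.

Theorem theorem5 (R : realType) (d m c : nat) (n_ : 'I_c -> nat)
    (Xs : forall i : 'I_c, 'M[R]_(d, n_ i))
    (hn : forall i : 'I_c, (1 <= n_ i)%N)
    (hm : (1 <= m <= d)%N)
    (hX : centered Xs) :
  (forall (W W' : 'M[R]_(d, m)) (mu mu' : 'I_c -> 'cV[R]_d),
     orthonormal_cols W ->
     rlda_step Xs W mu W' mu' ->
     lda_obj Xs W' mu' <= lda_obj Xs W mu)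
  /\
  (forall (T : nat) (W : nat -> 'M[R]_(d, m)) (mu : nat -> 'I_c -> 'cV[R]_d),
     rlda_run Xs T W mu ->
     forall t : nat, (t < T)%N ->
       lda_obj Xs (W t.+1) (mu t.+1) <= lda_obj Xs (W t) (mu t)).
Proof.
split=> [W W' mu mu' hW hs|T W mu [hW0 _ hs] t ltT]; first exact: lda_obj_step hs.
apply: lda_obj_step (hs t ltT) => //.
(* The current iterate is orthonormal by initialization at index 0, and afterwards as the minimizer
   chosen in the preceding step. *)
case: t ltT => [//|t] ltT.
by have [_ _ []] := hs t (ltnW ltT).
Qed.
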